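(* Let $1\le k\le N-1$ and let $L$ be a real symmetric positive semidefinite $N\times N$ matrix with $Z_k(L)>0$, with spectral decomposition $L=U\Lambda U^{\top}$, where $U\in O(N)$ and $\Lambda$ is diagonal. Let $c>0$, let $D=\mathrm{diag}(\varepsilon_1,\ldots,\varepsilon_N)$ with each $\varepsilon_i\in\{1,-1\}$, and let $Q\in O(N)$ satisfy $Q\Lambda Q^{\top}=\Lambda$. Put $$M=(DUQ)(c\Lambda)(DUQ)^{\top}.$$ Then $P^k_M=P^k_L$. In particular, the $k$-DPP with kernel $U\Lambda U^{\top}$ is invariant under each of the following transformations of the spectral components: 1. (Scale) $\Lambda\mapsto c\Lambda$ for $c>0$; 2. (Sign similarity) $U\mapsto DU$ for $D$ a diagonal matrix with diagonal entries in $\{1,-1\}$; 3. (Eigenspace rotation) $U\mapsto UQ$ for $Q\in O(N)$ with $Q\Lambda=\Lambda Q$.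
   Context: Let $\mathcal{Y}=\{1,\ldots,N\}$ and $\mathcal{X}_k=\{A\subseteq\mathcal{Y}:|A|=k\}$. For an $N\times N$ matrix $L$ and $A\subseteq\mathcal{Y}$, $L_A$ is the principal submatrix with rows and columns in $A$. For a real symmetric positive semidefinite $L$ put $Z_k(L)=\sum_{A\in\mathcal{X}_k}\det(L_A)$; if $Z_k(L)>0$, the $k$-DPP with kernel $L$ is the probability measure on $\mathcal{X}_k$ given by $P^k_L(A)=\det(L_A)/Z_k(L)$. $O(N)$ is the group of real orthogonal $N\times N$ matrices. *)

(* Defs.v *)
From HB Require Import structures.
From mathcomp Require Import all_boot all_order all_algebra.
From mathcomp Require Import all_classical all_reals all_analysis.

Set Implicit Arguments.
Unset Strict Implicit.
Unset Printing Implicit Defensive.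

Import Order.TTheory GRing.Theory Num.Theory.
Import numFieldNormedType.Exports.

Local Open Scope classical_set_scope.
Local Open Scope ring_scope.

(* The ground set {1, ..., N} is 'I_N.  The library's measurable types are
   nonempty, whence the range 0 <= k <= N, i.e. k : 'I_N.+1. *)
Record ksubset (N : nat) (k : 'I_N.+1) : Type := KSubset {
  ksubset_set :> {set 'I_N};
  card_ksubset : #|ksubset_set| == k
}.

HB.instance Definition _ (N : nat) (k : 'I_N.+1) :=
  [isSub for @ksubset_set N k].
HB.instance Definition _ (N : nat) (k : 'I_N.+1) :=
  [Finite of ksubset k by <:].

Lemma card_initial_segment (N : nat) (k : 'I_N.+1) :
  #|[set i : 'I_N | (i < k)%N]%SET| == k.
Proof.
rewrite cardsE -sum1_card.
rewrite -(big_ord_widen N (fun=> 1%N)) ?sum1_card ?card_ord //.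
by rewrite -ltnS.
Qed.

HB.instance Definition _ (N : nat) (k : 'I_N.+1) :=
  isPointed.Build (ksubset k)
    (KSubset (card_initial_segment k)).

HB.instance Definition _ (N : nat) (k : 'I_N.+1) :=
  @isMeasurable.Build default_measure_display (ksubset k)
    discrete_measurable discrete_measurable0
    discrete_measurableC discrete_measurableU.

Definition principal_submx (R : realType) (N : nat) (L : 'M[R]_N)
    (A : {set 'I_N}) : 'M[R]_#|A| :=
  \matrix_(i, j) L (enum_val i) (enum_val j).

Definition sym_psd (R : realType) (N : nat) (L : 'M[R]_N) : Prop :=
  L^T = L /\ forall x : 'cV[R]_N, 0 <= (x^T *m L *m x) 0 0.

Definition orthogonal_mx (R : realType) (N : nat) (U : 'M[R]_N) : Prop :=
  U^T *m U = 1%:M.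

Definition kdpp_Z (R : realType) (N : nat) (k : 'I_N.+1) (L : 'M[R]_N) : R :=
  \sum_(A : ksubset k) \det (principal_submx L A).

Definition kdpp_kernel (R : realType) (N : nat) (k : 'I_N.+1)
    (L : 'M[R]_N) : Prop :=
  sym_psd L /\ 0 < kdpp_Z k L.

Definition kdpp_pmf (R : realType) (N : nat) (k : 'I_N.+1) (L : 'M[R]_N)
    (A : ksubset k) : R :=
  \det (principal_submx L A) / kdpp_Z k L.

(* \det (t%:M + B) is monic in t and has no root t > 0. *)
Lemma det_psd_ge0 (R : realType) (n : nat) (B : 'M[R]_n) :
  (forall x : 'cV[R]_n, 0 <= (x^T *m B *m x) 0 0) -> 0 <= \det B.
Proof.
move=> psdB; set p := char_poly (- B).
have pE t : p.[t] = \det (t%:M + B).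
  transitivity (horner_eval t p) => //; rewrite /p /char_poly -det_map_mx.
  congr (\det _); apply/matrixP => i j.
  by rewrite !mxE /= /horner_eval !hornerE hornerMn hornerX opprK.
rewrite leNgt; apply/negP => detB_lt0.
have p0 : p.[0] < 0 by rewrite pE raddf0 add0r.
have [b pb] := monic_Cauchy_bound (char_poly_monic (- B)).
set c := Num.max b 0.
have c0 : 0 <= c by rewrite le_max lexx orbT.
have pc : 0 <= p.[c] by apply/ltW/pb; rewrite le_max lexx.
have [t /andP[t0 _] /rootP pt] : exists2 t, 0 <= t <= c & root p t.
  have [] := @poly_ivt R p 0 c c0; first by rewrite (ltW p0) pc.
  by move=> t tc rt; exists t => //; rewrite -in_itv.
have tgt0 : 0 < t.
  rewrite lt_neqAle t0 andbT; apply/eqP => t_eq0.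
  by move: p0; rewrite {1}t_eq0 pt ltxx.
move/eqP: pt; rewrite pE => /det0P[v v0 vB].
have := psdB v^T; rewrite trmxK.
have -> : v *m B = - (t *: v).
  by apply/eqP; rewrite -subr_eq0 opprK addrC -mul_mx_scalar -mulmxDr vB.
rewrite mulNmx -scalemxAl mxE mxE oppr_ge0.
rewrite pmulr_rle0 // mxE => le0.
move/negP: v0; apply; apply/eqP/rowP => i; rewrite mxE.
have sq_ge0 j : true -> 0 <= v 0 j * v^T j 0 by rewrite mxE -expr2 sqr_ge0.
have s0 : \sum_j v 0 j * v^T j 0 = 0.
  by apply/eqP; rewrite eq_le le0 sumr_ge0.
have : v 0 i * v^T i 0 = 0 by exact: (psumr_eq0P sq_ge0 s0).
by rewrite mxE => /eqP; rewrite mulf_eq0 orbb => /eqP.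
Qed.

Lemma kdpp_pmf_ge0 (R : realType) (N : nat) (k : 'I_N.+1) (L : 'M[R]_N)
    (A : ksubset k) : kdpp_kernel k L -> 0 <= kdpp_pmf L A.
Proof.
move=> [[_ psdL] Zgt0]; apply: divr_ge0; last exact: ltW.
apply: det_psd_ge0 => x.
pose S : 'M[R]_(#|A|, N) := \matrix_(i, j) (enum_val i == j)%:R.
suff -> : principal_submx L A = S *m L *m S^T.
  have := psdL (S^T *m x).
  by rewrite trmx_mul trmxK !mulmxA.
apply/matrixP => i j; rewrite !mxE.
rewrite (bigD1 (enum_val j)) //= !mxE eqxx mulr1 (bigD1 (enum_val i)) //=.
rewrite !mxE eqxx mul1r !big1 ?addr0 // => l ne.
- by rewrite !mxE eq_sym (negbTE ne) mulr0.
- by rewrite !mxE eq_sym (negbTE ne) mul0r.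
Qed.

(* The proof hL does not occur in the formula; it is an argument because the
   set function is a probability measure only for such kernels. *)
Definition kdpp_fun (R : realType) (N : nat) (k : 'I_N.+1) (L : 'M[R]_N)
    (hL : kdpp_kernel k L) (E : set (ksubset k)) : \bar R :=
  (\sum_(A \in E) (kdpp_pmf L A)%:E)%E.

Section kdpp_probability.
Variables (R : realType) (N : nat) (k : 'I_N.+1) (L : 'M[R]_N).
Hypothesis hL : kdpp_kernel k L.

Let kdpp0 : kdpp_fun hL set0 = 0%E.
Proof. by rewrite /kdpp_fun fsbig_set0. Qed.

Let kdpp_ge0 E : (0 <= kdpp_fun hL E)%E.
Proof.
rewrite /kdpp_fun fsbig_finite//= sumEFin lee_fin.
by apply: sumr_ge0 => A _; exact: kdpp_pmf_ge0.
Qed.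

Let kdpp_sigma_additive : semi_sigma_additive (kdpp_fun hL).
Proof.
have pmf0 (A : ksubset k) : (0 <= (kdpp_pmf L A)%:E)%E by rewrite lee_fin; exact: kdpp_pmf_ge0.
move=> F mF tF mUF; apply: cvg_toP.
  apply: ereal_nondecreasing_is_cvgn => m n mn.
  by apply: lee_sum_nneg_natr => // i _ _; exact: kdpp_ge0.
transitivity (\sum_(0 <= i <oo) (\esum_(A in F i) (kdpp_pmf L A)%:E))%E.
  by apply: eq_eseriesr => i _; rewrite esum_fset; [|exact: finite_finset|].
by rewrite -nneseries_sum_bigcup // esum_fset //; exact: finite_finset.
Qed.

HB.instance Definition _ := isMeasure.Build _ _ _ (kdpp_fun hL)
  kdpp0 kdpp_ge0 kdpp_sigma_additive.

Let kdpp_setT : kdpp_fun hL [set: _] = 1%E.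
Proof.
rewrite /kdpp_fun (fsbigE (index_enum (ksubset k))) ?index_enum_uniq //; last first.
  by move=> A _; rewrite mem_index_enum.
rewrite sumEFin (eq_bigl xpredT); last by move=> A; rewrite in_setT.
by rewrite -mulr_suml divff // gt_eqF // hL.2.
Qed.

HB.instance Definition _ :=
  @Measure_isProbability.Build _ _ R (kdpp_fun hL) kdpp_setT.

End kdpp_probability.

Definition kDPP (R : realType) (N : nat) (k : 'I_N.+1) (L : 'M[R]_N)
    (hL : kdpp_kernel k L) : probability (ksubset k) R :=
  kdpp_fun hL.

(* Main.v *)
(* The rotation Q cancels, so M = c D L D. Hence M_A = c D_A L_A D_A, and
   since det(D_A)^2 = 1, every principal minor of order k is multiplied by the
   same factor c^k, which cancels in the normalization. The three particular
   transformations are the cases where the other two are trivial. *)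
Require Import Defs.
From mathcomp Require Import all_boot all_order all_algebra.
From mathcomp Require Import all_classical all_reals all_analysis.

Set Implicit Arguments.
Unset Strict Implicit.
Unset Printing Implicit Defensive.

Import Order.TTheory GRing.Theory Num.Theory.
Import numFieldNormedType.Exports.

Local Open Scope ring_scope.

(** A probability packs a set function with proofs of propositions, so by proof irrelevance the
    function alone determines it. *)
Lemma eq_probability d (T : measurableType d) (R : realType)
    (P Q : probability T R) :
  P = Q :> (set T -> \bar R) -> P = Q.
Proof.
case: P => p cp; case: Q => q cq /= pq; subst q.
congr Probability.Pack.
case: cp => [[ge0 add] [sadd] [sfin] [sigfin] [fin] [sub] [prob]].
case: cq => [[ge0' add'] [sadd'] [sfin'] [sigfin'] [fin'] [sub'] [prob']].
(* The later components are built over the content axioms, so the proofs of these are identified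
   first. *)
rewrite (Prop_irrelevance ge0' ge0).
move: sadd'; rewrite (Prop_irrelevance add' add) => sadd'.
by congr Probability.Class; congr (_ _); exact: Prop_irrelevance.
Qed.

Section sign_scale.
Variables (R : realType) (N : nat) (k : 'I_N.+1) (L M : 'M[R]_N).
Variables (c : R) (eps : 'rV[R]_N).
Hypothesis c_gt0 : 0 < c.
Hypothesis epsP : forall i, eps 0 i = 1 \/ eps 0 i = -1.
Hypothesis ME : M = c *: (diag_mx eps *m L *m diag_mx eps).

Lemma det_principal_submx_sign_scale (A : ksubset k) :
  \det (principal_submx M A) = c ^+ k * \det (principal_submx L A).
Proof.
pose D : 'M[R]_#|A| := diag_mx (\row_i eps 0 (enum_val i)).
have -> : principal_submx M A = c *: (D *m principal_submx L A *m D).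
  apply/matrixP => i j.
  by rewrite !mul_diag_mx !mul_mx_diag ME !mul_diag_mx !mul_mx_diag !mxE.
have detD2 : \det D * \det D = 1.
  rewrite det_diag -big_split big1 //= => i _; rewrite !mxE.
  by case: (epsP (enum_val i)) => ->; rewrite ?mulrNN mulr1.
rewrite detZ !det_mulmx mulrAC detD2 mul1r.
(* The scalar leaves the determinant with exponent [#|A|], which is [k] for every [A] in
   [ksubset k]. *)
by congr (c ^+ _ * _); exact/eqP/card_ksubset.
Qed.

Lemma kdpp_Z_sign_scale : kdpp_Z k M = c ^+ k * kdpp_Z k L.
Proof.
rewrite /kdpp_Z mulr_sumr; apply: eq_bigr => A _.
exact: det_principal_submx_sign_scale.
Qed.

Lemma kdpp_pmf_sign_scale (A : ksubset k) : kdpp_pmf M A = kdpp_pmf L A.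
Proof.
rewrite /kdpp_pmf det_principal_submx_sign_scale kdpp_Z_sign_scale.
(* Only [c ^+ k] is cancelled, nonzero because [c > 0]. *)
by rewrite -mulf_div divff ?mul1r // expf_neq0 // gt_eqF.
Qed.

Lemma kdpp_kernel_sign_scale : kdpp_kernel k L -> kdpp_kernel k M.
Proof.
move=> [[symL psdL] Z_gt0]; split; last first.
  by rewrite kdpp_Z_sign_scale mulr_gt0 // exprn_gt0.
split; first by rewrite ME linearZ /= !trmx_mul tr_diag_mx symL mulmxA.
move=> x; rewrite ME -scalemxAr -scalemxAl mxE.
apply: mulr_ge0; first exact: ltW.
(* The quadratic form of [M] at [x] is [c] times that of [L] at [diag_mx eps *m x]. *)
by have := psdL (diag_mx eps *m x); rewrite trmx_mul tr_diag_mx !mulmxA.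
Qed.

(** The existential supplies the proof that [kDPP] requires: [M] is again an admissible kernel. Both
    measures sum their mass functions, which agree pointwise. *)
Lemma kDPP_sign_scale (hL : kdpp_kernel k L) :
  exists hM : kdpp_kernel k M, kDPP hM = kDPP hL.
Proof.
exists (kdpp_kernel_sign_scale hL); apply: eq_probability.
apply/funext => E; apply: eq_fsbigr => A _.
by rewrite kdpp_pmf_sign_scale.
Qed.

End sign_scale.

Theorem theorem1 (R : realType) (N : nat) (k : 'I_N.+1)
    (L U Lam : 'M[R]_N)
    (hk : (1 <= k <= N - 1)%N)
    (hL : kdpp_kernel k L)
    (hU : orthogonal_mx U)
    (hLam : is_diag_mx Lam)
    (hULU : L = U *m Lam *m U^T) :
  (forall (c : R) (eps : 'rV[R]_N) (Q : 'M[R]_N),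
     0 < c ->
     (forall i, eps 0 i = 1 \/ eps 0 i = -1) ->
     orthogonal_mx Q ->
     Q *m Lam *m Q^T = Lam ->
     let V := diag_mx eps *m U *m Q in
     let M := V *m (c *: Lam) *m V^T in
     exists hM : kdpp_kernel k M, kDPP hM = kDPP hL) /\
  (forall c : R,
     0 < c ->
     exists hM : kdpp_kernel k (U *m (c *: Lam) *m U^T),
       kDPP hM = kDPP hL) /\
  (forall eps : 'rV[R]_N,
     (forall i, eps 0 i = 1 \/ eps 0 i = -1) ->
     let V := diag_mx eps *m U in
     exists hM : kdpp_kernel k (V *m Lam *m V^T), kDPP hM = kDPP hL) /\
  (forall Q : 'M[R]_N,
     orthogonal_mx Q ->
     Q *m Lam = Lam *m Q ->
     let V := U *m Q in
     exists hM : kdpp_kernel k (V *m Lam *m V^T), kDPP hM = kDPP hL).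
Proof.
have diag1 : diag_mx (const_mx 1) = 1%:M :> 'M[R]_N by rewrite diag_const_mx.
have one_sign i : (const_mx 1 : 'rV[R]_N) 0 i = 1 \/ (const_mx 1 : 'rV[R]_N) 0 i = -1.
  by left; rewrite mxE.
have all_at_once (c : R) (eps : 'rV[R]_N) (Q : 'M[R]_N) : 0 < c ->
    (forall i, eps 0 i = 1 \/ eps 0 i = -1) -> Q *m Lam *m Q^T = Lam ->
    let V := diag_mx eps *m U *m Q in
    exists hM : kdpp_kernel k (V *m (c *: Lam) *m V^T), kDPP hM = kDPP hL.
  move=> c_gt0 epsP QLam V; apply: (kDPP_sign_scale c_gt0 epsP).
  (* Expanding [Lam] as [Q *m Lam *m Q^T] inside [L] turns both sides into the same product. *)
  rewrite -scalemxAr -scalemxAl hULU -[in RHS]QLam /V.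
  by rewrite !trmx_mul tr_diag_mx !mulmxA.
have triv : 1%:M *m Lam *m 1%:M^T = Lam by rewrite trmx1 mul1mx mulmx1.
split; first by move=> c eps Q c_gt0 epsP _; exact: all_at_once.
split.
  move=> c c_gt0; have := all_at_once c _ _ c_gt0 one_sign triv.
  by rewrite diag1 mul1mx mulmx1.
split.
  move=> eps epsP; have := all_at_once 1 eps _ ltr01 epsP triv.
  by rewrite scale1r mulmx1.
move=> Q oQ QLam; have := all_at_once 1 _ Q ltr01 one_sign.
rewrite diag1 mul1mx scale1r; apply.
(* Commutation becomes invariance under conjugation: [Q *m Lam *m Q^T = Lam *m (Q *m Q^T)], and
   [mulmx1C] turns the left inverse [Q^T] into a right one. *)
by rewrite QLam -mulmxA (mulmx1C oQ) mulmx1.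
Qed.
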